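(* For a positive integer $n$, let $\Omega(n)$ denote the number of prime factors of $n$ counted with multiplicity (so $\Omega(1)=0$). Then for every bounded function $f\colon\mathbb{N}\to\mathbb{C}$ one has \[ \frac{1}{N}\sum_{n=1}^N f(\Omega(n)+1)\;-\;\frac{1}{N}\sum_{n=1}^N f(\Omega(n))\;\longrightarrow\;0\qquad\text{as } N\to\infty. \]
   Context: $\mathbb{N}=\{1,2,3,\ldots\}$. Since $\Omega(1)=0$, the value $f(0)$ is used when $n=1$; $f$ is assumed to be defined and bounded on $\mathbb{N}\cup\{0\}$. *)

(* Defs.v *)
From mathcomp Require Import all_boot.

Set Implicit Arguments.
Unset Strict Implicit.
Unset Printing Implicit Defensive.

Definition num_prime_factors (n : nat) : nat := \sum_(p <- primes n) logn p n.

(* Main.v *)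
Require Import Defs.
From mathcomp Require Import all_boot all_order all_algebra.
From mathcomp Require Import all_classical all_reals all_analysis.
From mathcomp Require Import complex.
From mathcomp Require Import zify ring lra.

(** Write S(N) for the sum of g(Omega(n)) over n <= N, and S' for the same sum
with g shifted by one. For weights nu on primes with total mass 1 and small
energy, the sum of p nu_p^2, a Turan-Kubilius second moment estimate gives
  S(N) = sum_p nu_p p S'(N/p) + o(N),
so it suffices that the mean S(N)/N is asymptotically invariant under
dilations: then the right-hand side is S'(N) + o(N).

The block (4^n, 4^(n+1)] contains at least c 4^n/n primes, while a subinterval
of relative length delta contains at most C delta log(1/delta) 4^n/n of them,
because these primes divide a binomial coefficient. Hence if the block is cut
into short cells, two cells which are close to each other, but many cells apart,
both contain many primes. By pigeonhole the same two cell positions i < j serve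
for a set of n whose harmonic sum is large. Averaging over the primes in the
cells i, and over those in the cells j, yields the same average of S' up to a
dilation by the ratio rho of the two positions, so S(rho x) = rho S(x) up to an
error which is small compared to (rho - 1) x. Iterating this for ratios rho
tending to 1 gives invariance under every dilation. *)

Import Order.TTheory GRing.Theory Num.Theory.
Import numFieldNormedType.Exports.

(** * The number of prime factors of p n *)

Lemma num_prime_factorsE n b : n <= b ->
  num_prime_factors n = \sum_(p < b.+1 | prime p) logn p n.
Proof.
move=> leb; rewrite /num_prime_factors.
have -> : \sum_(p < b.+1 | prime p) logn p n
        = \sum_(p <- index_iota 0 b.+1 | p \in primes n) logn p n.
  rewrite big_mkord [RHS]big_mkcond [LHS]big_mkcond; apply: eq_bigr => p _.
  rewrite -logn_gt0; case: ifP => // pr; case: ltngtP => //.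
  by rewrite lognE pr.
rewrite -[RHS]big_filter; apply: perm_big; apply: uniq_perm.
- exact: primes_uniq.
- by rewrite filter_uniq ?iota_uniq.
move=> p; rewrite mem_filter mem_index_iota /=.
case: (boolP (p \in primes n)) => //=; rewrite mem_primes => /and3P[_ n0 pn].
by have := dvdn_leq n0 pn; rewrite ltnS => /leq_trans -> .
Qed.

(** Over a common range of primes the valuations of n and p n can be compared term by term, and they
    differ only at p. *)
Lemma num_prime_factors_mulp p n : prime p -> 0 < n ->
  num_prime_factors (p * n) = (num_prime_factors n).+1.
Proof.
move=> pr n0; have p0 := prime_gt0 pr.
have lb : p <= p * n by rewrite leq_pmulr.
rewrite (@num_prime_factorsE (p * n) (p * n)) // (@num_prime_factorsE n (p * n)) ?leq_pmull //.
rewrite (eq_bigr (fun q : 'I_ _ => (q == p :> nat) + logn q n)); last first.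
  by move=> q _; rewrite lognM // logn_prime.
rewrite big_split /= -[RHS]add1n; congr (_ + _).
have lp : p < (p * n).+1 by [].
rewrite (bigD1 (Ordinal lp)) //= eqxx big1 // => q /andP[_].
by rewrite -val_eqE /= => /negbTE ->.
Qed.

(** * Chebyshev bounds *)

Definition primes_in a b := [seq p <- index_iota a.+1 b.+1 | prime p].
Notation pcount a b := (size (primes_in a b)).

Lemma mem_primes_in a b p : (p \in primes_in a b) = [&& prime p, a < p & p <= b].
Proof. by rewrite mem_filter mem_index_iota ltnS. Qed.

Lemma primes_in_uniq a b : uniq (primes_in a b).
Proof. by rewrite filter_uniq ?iota_uniq. Qed.

Lemma primes_in_cat a b c : a <= b -> b <= c ->
  primes_in a c = primes_in a b ++ primes_in b c.
Proof.
move=> ab bc; rewrite /primes_in -filter_cat /index_iota.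
have -> : c.+1 - a.+1 = (b.+1 - a.+1) + (c.+1 - b.+1) by lia.
by rewrite iotaD (_ : a.+1 + (b.+1 - a.+1) = b.+1) //; lia.
Qed.

Lemma pcountD a b c : a <= b -> b <= c -> pcount a c = pcount a b + pcount b c.
Proof. by move=> ab bc; rewrite (primes_in_cat _ _ _ ab bc) size_cat. Qed.

Lemma pcount_le a b : pcount a b <= b - a.
Proof. by rewrite size_filter (leq_trans (count_size _ _)) // size_iota subSS. Qed.

Lemma prod_primes_dvd (s : seq nat) m : uniq s ->
  {in s, forall p, prime p && (p %| m)} -> \prod_(p <- s) p %| m.
Proof.
elim: s => [|p s IH] /=; first by rewrite big_nil dvd1n.
move=> /andP[ps us] h; rewrite big_cons Gauss_dvd; last first.
  rewrite big_seq; apply: (big_ind (fun x => coprime p x)); first by rewrite coprimen1.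
    by move=> x y cx cy; rewrite coprimeMr cx cy.
  move=> q qs; have /andP[pp _] := h p (mem_head _ _).
  have /andP[pq _] : prime q && (q %| m) by apply: h; rewrite inE qs orbT.
  rewrite prime_coprime // dvdn_prime2 //; apply: contraNneq ps => ->; exact: qs.
have /andP[_ ->] := h p (mem_head _ _).
by apply: IH => // q qs; apply: h; rewrite inE qs orbT.
Qed.

(** A prime in (a, b] divides b! but neither a! nor (b - a)!, as both factorials only involve
    numbers up to a. *)
Lemma prod_primes_in_dvd_bin a b : a <= b -> b - a <= a ->
  \prod_(p <- primes_in a b) p %| 'C(b, a).
Proof.
move=> ab ba; apply: prod_primes_dvd; first exact: primes_in_uniq.
move=> p; rewrite mem_primes_in => /and3P[pr ap pb]; rewrite pr /=.
have /dvdn_fact : 0 < p <= b by rewrite prime_gt0.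
rewrite -(bin_fact ab) !Euclid_dvdM //.
have nf c : c <= a -> ~~ (p %| c`!).
  move=> ca; rewrite fact_prod; apply/negP.
  rewrite big_seq; apply: (big_ind (fun x => p %| x -> False)).
  - by rewrite dvdn1 => /eqP p1; rewrite p1 in pr.
  - by move=> x y hx hy; rewrite Euclid_dvdM // => /orP[/hx|/hy].
  move=> i; rewrite mem_index_iota => /andP[i0 ic] /dvdn_leq -/(_ i0); lia.
by rewrite (negbTE (nf _ (leqnn _))) (negbTE (nf _ ba)) !orbF.
Qed.

Lemma expn_pcount_le_prod a b : a ^ pcount a b <= \prod_(p <- primes_in a b) p.
Proof.
have : {in primes_in a b, forall p, a <= p}.
  by move=> p; rewrite mem_primes_in => /and3P[_ /ltnW].
elim: (primes_in a b) => [|p s IH] h; first by rewrite big_nil.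
rewrite big_cons /= expnS leq_mul ?h ?mem_head // IH // => q qs.
by apply: h; rewrite inE qs orbT.
Qed.

Lemma bin_le_expn2 n k : 'C(n, k) <= 2 ^ n.
Proof.
case: (leqP k n) => kn; last by rewrite bin_small.
rewrite -[2]/(1 + 1) expnDn (bigD1 (Ordinal (kn : k < n.+1))) //=.
by rewrite !exp1n !muln1 leq_addr.
Qed.

(** Doubling: the product of the primes in (2^k, 2^(k+1)] divides a binomial coefficient which is at
    most 2^(2^(k+1)) = 4^(2^k). *)
Lemma primorial_pow2 k : \prod_(p <- primes_in 0 (2 ^ k)) p <= 4 ^ (2 ^ k).
Proof.
elim: k => [|k IH]; first by rewrite big_nil.
have le2 : 2 ^ k <= 2 ^ k.+1 by rewrite leq_exp2l.
rewrite (primes_in_cat _ (2 ^ k)) // big_cat /=.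
rewrite [2 ^ k.+1]expnS mul2n -addnn expnD leq_mul //.
have sub : 2 ^ k + 2 ^ k - 2 ^ k <= 2 ^ k by rewrite addnK.
have := dvdn_leq _ (prod_primes_in_dvd_bin (2 ^ k) (2 ^ k + 2 ^ k) (leq_addr _ _) sub).
rewrite bin_gt0 leq_addr => /(_ isT) /leq_trans; apply.
by rewrite (leq_trans (bin_le_expn2 _ _)) // addnn -mul2n expnM.
Qed.

Lemma sum_leq_minn n L : \sum_(1 <= k < n.+1) (k <= L) = minn n L.
Proof.
elim: n => [|n IH]; first by rewrite big_geq // min0n.
by rewrite big_nat_recr //= IH; case: (leqP n.+1 L); lia.
Qed.

(** By Legendre's formula the exponent is the sum over k of floor(2m/p^k) - 2 floor(m/p^k). Each
    term is 0 or 1, and it vanishes once p^k > 2m. *)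
Lemma pfactor_central_bin_le p m : prime p -> 0 < m ->
  logn p 'C(m.*2, m) <= trunc_log p m.*2.
Proof.
move=> pr m0; have p1 := prime_gt1 pr.
have mm : m <= m.*2 by rewrite -addnn leq_addr.
have := bin_fact mm; rewrite -{2}addnn addnK => /(congr1 (logn p)).
rewrite !lognM ?muln_gt0 ?fact_gt0 ?bin_gt0 // !logn_fact //.
have -> : \sum_(1 <= k < m.+1) m %/ p ^ k = \sum_(1 <= k < (m.*2).+1) m %/ p ^ k.
  rewrite [RHS](@big_cat_nat _ _ _ m.+1) //= [X in _ + X]big1_seq ?addn0 // => k.
  rewrite mem_index_iota => /andP[_ /andP[mk _]].
  by rewrite divn_small // (leq_trans mk) // ltnW // ltn_expl.
rewrite addnn => E.
suff : \sum_(1 <= k < (m.*2).+1) m.*2 %/ p ^ k <=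
  (\sum_(1 <= k < (m.*2).+1) m %/ p ^ k).*2 + \sum_(1 <= k < (m.*2).+1) (k <= trunc_log p m.*2).
  by rewrite sum_leq_minn; lia.
rewrite -[X in X + _]addnn -!big_split /=; apply: leq_sum => k _.
rewrite -[m.*2]addnn divnD ?expn_gt0 ?prime_gt0 // leq_add2l.
case: (leqP (p ^ k) _) => // h; rewrite lt0b.
by apply: trunc_log_max => //; rewrite (leq_trans h) // leq_add // leq_mod.
Qed.

Lemma central_bin_ge m : 0 < m -> 4 ^ m <= m.*2 * 'C(m.*2, m).
Proof.
elim: m => // -[_ _|m IH _] //.
have {IH} := IH isT; set k := m.+1 => IH.
have e1 : k.+1 * 'C(k.+1.*2, k.+1) = k.+1.*2 * 'C(k.*2.+1, k).
  by rewrite -mul_bin_diag.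
have e2 : k.+1 * 'C(k.*2.+1, k) = k.*2.+1 * 'C(k.*2, k).
  by have := mul_bin_down k.*2.+1 k; rewrite /=; lia.
rewrite expnS; nia.
Qed.

Lemma bin_prod_primes_in m : 0 < m ->
  'C(m.*2, m) = \prod_(p <- primes_in 0 m.*2) p ^ logn p 'C(m.*2, m).
Proof.
move=> m0; have C0 : 0 < 'C(m.*2, m) by rewrite bin_gt0 -addnn leq_addr.
rewrite {1}(prod_prime_decomp C0) prime_decompE big_map /=.
rewrite [RHS](bigID [in primes 'C(m.*2, m)]) /= [X in _ * X]big1 ?muln1; last first.
  by move=> p; rewrite -logn_gt0 -eqn0Ngt => /eqP ->.
rewrite -[RHS]big_filter; apply: perm_big; apply: uniq_perm.
- exact: primes_uniq.
- by rewrite filter_uniq ?primes_in_uniq.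
move=> p; rewrite mem_filter mem_primes_in.
case: (boolP (p \in _)) => //= pC; have := pC; rewrite mem_primes => /and3P[pr _ _].
rewrite pr prime_gt0 //=; apply/esym.
have := leq_trans (_ : 0 < logn p _) (pfactor_central_bin_le _ _ pr m0).
by rewrite logn_gt0 pC trunc_log_gt0 => /(_ isT) /andP[]; have := prime_gt0 pr; lia.
Qed.

Lemma leq_prod_const (s : seq nat) F c :
  {in s, forall p, F p <= c} -> \prod_(p <- s) F p <= c ^ size s.
Proof.
elim: s => [|p s IH] h; first by rewrite big_nil.
rewrite big_cons /= expnS leq_mul ?h ?mem_head // IH // => q qs.
by apply: h; rewrite inE qs orbT.
Qed.

(* Each prime contributes at most 4^(n+1) to the binomial coefficient of 4^(n+1)
   and 2 4^n. The primes up to 2^(n+1) are few, and those between 2^(n+1) and 4^n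
   have exponent at most 1, so that the primorial bound applies to them. *)
Lemma pcount_block_ge n : 4 < n -> 4 ^ n <= 2 * n.+1 * pcount (4 ^ n) (4 ^ n.+1).
Proof.
move=> n4; set P := pcount _ _; set m := 2 * 4 ^ n.
have m2 : m.*2 = 4 ^ n.+1 by rewrite -mul2n mulnA expnS.
have m0 : 0 < m by rewrite muln_gt0 expn_gt0.
have e4 k : 4 ^ k = 2 ^ k * 2 ^ k by rewrite -expnMn.
have le1 : 2 ^ n.+1 <= 4 ^ n by rewrite -[4]/(2 ^ 2) -expnM leq_exp2l //; lia.
have le2 : 4 ^ n <= 4 ^ n.+1 by rewrite leq_exp2l.
have pk p : prime p -> p ^ logn p 'C(m.*2, m) <= m.*2.
  move=> pr; apply: leq_trans (trunc_logP (prime_gt1 pr) _); last by rewrite double_gt0.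
  by rewrite leq_pexp2l ?prime_gt0 // pfactor_central_bin_le.
have : 'C(m.*2, m) <= (4 ^ n.+1) ^ 2 ^ n.+1 * 4 ^ (4 ^ n) * (4 ^ n.+1) ^ P.
  rewrite bin_prod_primes_in // m2 (primes_in_cat _ (4 ^ n)) // big_cat /= -m2.
  rewrite (primes_in_cat 0 (2 ^ n.+1)) // big_cat /=.
  have cst a b : \prod_(p <- primes_in a b) p ^ logn p 'C(m.*2, m) <= m.*2 ^ pcount a b.
    by apply: leq_prod_const => p; rewrite mem_primes_in => /and3P[/pk].
  rewrite leq_mul //; last by rewrite /P -m2 cst.
  rewrite leq_mul //.
    rewrite (leq_trans (cst _ _)) // leq_pexp2l ?double_gt0 //.
    by rewrite (leq_trans (pcount_le _ _)) // subn0.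
  apply: (@leq_trans (\prod_(p <- primes_in (2 ^ n.+1) (4 ^ n)) p)).
    rewrite big_seq [X in _ <= X]big_seq; apply: leq_prod => p.
    rewrite mem_primes_in => /and3P[pr lp _].
    rewrite -[X in _ <= X]expn1 leq_pexp2l ?prime_gt0 //.
    rewrite (leq_trans (pfactor_central_bin_le _ _ pr m0)) // m2.
    rewrite -ltnS -(ltn_exp2l _ _ (prime_gt1 pr)).
    apply: leq_ltn_trans (trunc_logP (prime_gt1 pr) _) _; first by rewrite expn_gt0.
    by rewrite e4 -mulnn ltn_mul.
  have -> : 4 ^ n = 2 ^ n.*2 by rewrite -mul2n expnM.
  rewrite (leq_trans _ (primorial_pow2 _)) //.
  rewrite [X in _ <= X](_ : _ = \prod_(p <- primes_in 0 (2 ^ n.+1)) p *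
     \prod_(p <- primes_in (2 ^ n.+1) (2 ^ n.*2)) p).
    rewrite leq_pmull // big_seq prodn_cond_gt0 // => p.
    by rewrite mem_primes_in => /and3P[/prime_gt0].
  by rewrite -big_cat -primes_in_cat // leq_exp2l //; lia.
move=> h; have := leq_trans (central_bin_ge _ m0) (leq_mul (leqnn _) h).
rewrite m2 -!expnM -!expnD leq_exp2l // => {}h.
(* Comparing exponents of 4 leaves 4^n <= (n+1)(1 + 2^(n+1)) + (n+1) P. It suffices that the first
   term is at most half of 4^n, which holds from n = 5 on. *)
suff : 2 * (n.+1 * (1 + 2 ^ n.+1)) <= 4 ^ n by rewrite /m in h *; nia.
move: n4 {h P m m2 m0 le1 le2 pk}; elim: n => // n IH; rewrite ltnS leq_eqVlt.
by move=> /orP[/eqP <- // | /IH {}IH]; rewrite [4 ^ _]expnS [2 ^ n.+2]expnS; nia.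
Qed.

Lemma ffact_le_expn b L : b ^_ L <= b ^ L.
Proof.
rewrite ffact_prod -[in X in _ <= b ^ X](card_ord L) -prod_nat_const.
by apply: leq_prod => i _; rewrite leq_subr.
Qed.

(** A weak Stirling bound: L^L is at most the falling factorial of 2L of length L, which is L! times
    a binomial coefficient below 4^L. *)
Lemma expn_le_fact L : L ^ L <= L`! * 4 ^ L.
Proof.
have : L ^ L <= L.*2 ^_ L.
  rewrite ffact_prod -[in X in L ^ X <= _](card_ord L) -prod_nat_const.
  by apply: leq_prod => i _; rewrite -addnn -addnBA ?leq_addr // ltnW.
rewrite -bin_ffact mulnC => /leq_trans; apply.
by rewrite leq_mul // (leq_trans (bin_le_expn2 _ _)) // -mul2n expnM.
Qed.

(** Each prime counted exceeds 4^n, and their product divides C(a + L, L). That coefficient is at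
    most (4(a + L)/L)^L, and 2^u is the ratio of 4^n to L, so its logarithm is about u L. *)
Lemma pcount_short_le n u a L : 4 ^ n = L * 2 ^ u -> 4 ^ n <= a ->
  a <= 4 ^ n.+1 -> n.*2 * pcount a (a + L) <= (u + 5) * L.
Proof.
move=> e la lb.
have L0 : 0 < L by move: (expn_gt0 4 n); rewrite e muln_gt0 => /andP[].
have La : L <= a by rewrite (leq_trans _ la) // e leq_pmulr // expn_gt0.
have h1 : (4 ^ n) ^ pcount a (a + L) <= 'C(a + L, L).
  have C0 : 0 < 'C(a + L, a) by rewrite bin_gt0 leq_addr.
  have sub : a + L - a <= a by rewrite addKn.
  have := dvdn_leq C0 (prod_primes_in_dvd_bin _ _ (leq_addr _ _) sub).
  rewrite -(bin_sub (leq_addl a L)) addnK; apply: leq_trans.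
  apply: leq_trans (expn_pcount_le_prod _ _).
  by case: (pcount _ _) => // k; rewrite leq_exp2r.
(* Here a + L <= (4 * 2^u + 1) L, so 4(a + L)/L <= 20 * 2^u <= 2^(u + 5). *)
have h2 : 'C(a + L, L) <= (2 ^ (u + 5)) ^ L.
  have LL : 0 < L ^ L by rewrite expn_gt0 L0.
  rewrite -(leq_pmul2r LL).
  apply: leq_trans (leq_mul (leqnn _) (expn_le_fact L)) _.
  rewrite mulnA bin_ffact; apply: leq_trans (leq_mul (ffact_le_expn _ _) (leqnn _)) _.
  rewrite -!expnMn leq_exp2r //; have := expn_gt0 2 u; move: lb; rewrite expnS expnD.
  by rewrite e; move: (2 ^ u) => w; nia.
have := leq_trans h1 h2; rewrite -[4]/(2 ^ 2) -!expnM leq_exp2l //; lia.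
Qed.

(** * Cells with many primes *)

Lemma pcount_sum (b : nat -> nat) a m : {homo b : x y / x <= y} -> a <= m ->
  pcount (b a) (b m) = \sum_(a <= i < m) pcount (b i) (b i.+1).
Proof.
move=> hb; elim: m => [|m IH].
  by rewrite leqn0 => /eqP ->; rewrite big_geq //; have := pcount_le (b 0) (b 0); lia.
rewrite leq_eqVlt => /orP[/eqP <-|]; first by rewrite big_geq //; have := pcount_le (b a) (b a); lia.
rewrite ltnS => am; rewrite big_nat_recr //= -IH //.
by rewrite -pcountD // hb.
Qed.

Lemma sum_pigeonhole (F : nat -> nat) m : 0 < m ->
  exists2 w, w < m & \sum_(0 <= i < m) F i <= m * F w.
Proof.
move=> m0; rewrite big_mkord; have [i _ hi] := @arg_maxnP _ (Ordinal m0) predT (fun i : 'I_m => F i) isT.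
exists i => //; apply: leq_trans (_ : \sum_(j < m) F i <= _).
  by apply: leq_sum => j _; apply: hi.
by rewrite sum_nat_const card_ord.
Qed.

(** The light cells together hold less than half of [M]. If every heavy cell lay within distance d
    of the first one, the heavy cells would also hold less than half. *)
Lemma two_heavy_cells (c : nat -> nat) a L d M : 0 < M ->
  M <= \sum_(a <= k < a + L) c k ->
  (forall i, a <= i < a + L -> 2 * \sum_(i <= k < i + d) c k < M) ->
  exists i j, [/\ a <= i, i + d <= j, j < a + L, M <= 2 * L * c i & M <= 2 * L * c j].
Proof.
move=> M0 hM hd; pose good k := M <= 2 * L * c k.
have bad : 2 * \sum_(a <= k < a + L | ~~ good k) c k < M.
  case: (posnP L) => [L0|L0]; first by move: hM; rewrite big_geq; lia.
  have : \sum_(a <= k < a + L | ~~ good k) 2 * L * c k <= \sum_(a <= k < a + L) M.-1.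
    rewrite big_mkcond leq_sum // => k _; case: ifP => //; rewrite /good; lia.
  rewrite -big_distrr /= sum_nat_const_nat; nia.
have split : \sum_(a <= k < a + L) c k =
   \sum_(a <= k < a + L | good k) c k + \sum_(a <= k < a + L | ~~ good k) c k.
  by rewrite (bigID good).
have ex : exists k, [&& a <= k, k < a + L & good k].
  have [/hasP[k]|/hasPn ng] := boolP (has good (index_iota a (a + L))).
    by rewrite mem_index_iota => /andP[ak kL] gk; exists k; rewrite ak kL.
  have : \sum_(a <= k < a + L | good k) c k = 0; last lia.
  by rewrite big_seq_cond big1 // => k /andP[/ng/negbTE ->].
case: (ex_minnP ex) => i /and3P[ai iL gi] imin.
have [/hasP[j]|/hasPn nj] := boolP (has (fun j => (i + d <= j) && good j) (index_iota a (a + L))).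
  rewrite mem_index_iota => /andP[_ jL] /andP[ij gj]; by exists i, j; split.
suff : \sum_(a <= k < a + L | good k) c k <= \sum_(i <= k < i + d) c k.
  have := hd i; rewrite ai iL => /(_ isT); lia.
rewrite -big_filter.
apply: (uniq_sub_le_big leqnn (fun x y => leq_addr y x)).
- by rewrite filter_uniq ?iota_uniq.
- exact: iota_uniq.
move=> k; rewrite mem_filter !mem_index_iota => /andP[gk /andP[ak kL]].
have kin : k \in index_iota a (a + L) by rewrite mem_index_iota ak kL.
have := nj k kin; rewrite gk andbT -ltnNge => ->; rewrite andbT.
by apply: imin; rewrite ak kL.
Qed.

(* For K a power of 2 dividing 4^n the cells i < 3 K partition (4^n, 4^(n+1)]. *)
Definition cell K n i := primes_in (4 ^ n %/ K * (K + i)) (4 ^ n %/ K * (K + i).+1).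

(* Half of the mean number of primes per cell guaranteed by [pcount_block_ge]. *)
Definition heavy K n i := 4 ^ n <= 12 * K * n.+1 * size (cell K n i).

(* 2^-v bounds the distance of the two cells from above, relative to 4^n, while
   2^s bounds the number of cells between them from below. The choice of r makes
   the primes in 2^s consecutive cells negligible among those in a window of
   2^(r-v) cells. *)
Lemma two_heavy_cells_block v s n (r := v.*2 + 10 + s) (K := 2 ^ r) : r <= n ->
  exists i j, [/\ i + 2 ^ s <= j, j < i + 2 ^ (r - v), j < 3 * K, heavy K n i & heavy K n j].
Proof.
move=> rn; set u := v.*2 + 10; pose h := 4 ^ n %/ K; set L := 2 ^ (r - v).
have dvK : K %| 4 ^ n by rewrite -[4]/(2 ^ 2) -expnM dvdn_exp2l //; lia.
have hK : h * K = 4 ^ n by rewrite divnK.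
have h0 : 0 < h by move: (expn_gt0 4 n); rewrite -hK muln_gt0 => /andP[].
have KL : 2 ^ v * L = K by rewrite -expnD; congr (2 ^ _); rewrite /r; lia.
have Ks : 2 ^ s * 2 ^ u = K by rewrite -expnD addnC.
have hb : {homo (fun i => h * (K + i)) : x y / x <= y}.
  by move=> x y xy; rewrite leq_mul2l leq_add2l xy orbT.
(* The block splits into 3 * 2^v windows of [L] cells; the fullest window has at least the average
   number of primes. *)
have [w wlt hw] := sum_pigeonhole (fun w => pcount (h * (K + w * L)) (h * (K + w.+1 * L)))
   (3 * 2 ^ v) ltac:(by rewrite muln_gt0 expn_gt0).
have hbL : {homo (fun w => h * (K + w * L)) : x y / x <= y}.
  by move=> x y xy; apply: hb; rewrite leq_mul2r xy orbT.
move: hw; set M := pcount _ _; rewrite -(pcount_sum _ _ _ hbL) //.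
rewrite mul0n addn0 -mulnA KL hK.
have -> : h * (K + 3 * K) = 4 ^ n.+1 by rewrite expnS -hK; lia.
move=> hw; have := pcount_block_ge n ltac:(lia); rewrite -/h => hP.
have hM : 4 ^ n <= 6 * 2 ^ v * n.+1 * M by apply: leq_trans hP _; nia.
have M0 : 0 < M by case: posnP hM => // ->; rewrite muln0 leqn0 expn_eq0.
have wL : w * L + L <= 3 * K by rewrite -KL mulnA -mulSnr leq_mul2r wlt orbT.
have [i [j [ai ij jL hi hj]]] : exists i j, [/\ w * L <= i, i + 2 ^ s <= j,
    j < w * L + L, M <= 2 * L * size (cell K n i) & M <= 2 * L * size (cell K n j)].
  apply: two_heavy_cells => //.
    rewrite /M (_ : w.+1 * L = w * L + L); last by rewrite mulSnr.
    by rewrite (pcount_sum _ _ _ hb) ?leq_addr //; apply: leq_sum => k _; rewrite /cell addnS.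
  move=> i /andP[ai iL].
  have e1 : 4 ^ n = h * 2 ^ s * 2 ^ u by rewrite -mulnA Ks.
  have := pcount_short_le n u (h * (K + i)) _ e1.
  rewrite -mulnDr -addnA expnS -hK => /(_ ltac:(nia) ltac:(nia)).
  rewrite (pcount_sum _ _ _ hb) ?leq_addr // (eq_bigr (fun k => size (cell K n k))); last first.
    by move=> k _; rewrite /cell addnS.
  move: (\sum_(_ <= _ < _) _) => c hc; rewrite ltnNge; apply/negP => Mc.
  (* The value u = 2v + 10 is chosen for this inequality, which keeps the primes in 2^s consecutive
     cells below half of [M]. *)
  have hv : 12 * 2 ^ v * (u + 5) < 2 ^ u.
    rewrite /u expnD -addnn expnD (_ : 2 ^ 10 = 1024) //.
    by have : v < 2 ^ v by [apply: ltn_expl]; nia.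
  have H0 : 0 < h * 2 ^ s by rewrite muln_gt0 h0 expn_gt0.
  have hn : n.+1 <= n.*2 by rewrite /r in rn; lia.
  have : 4 ^ n <= 12 * 2 ^ v * ((u + 5) * (h * 2 ^ s)).
    apply: leq_trans hM _; apply: leq_trans (leq_mul (leqnn _) hc).
    apply: leq_trans (leq_mul (leq_mul (leqnn _) hn) Mc) _.
    by apply: eq_leq; ring.
  move: hv; rewrite -(ltn_pmul2r H0) e1.
  by move: (h * 2 ^ s) (2 ^ u) (2 ^ v) => H U V; clear; lia.
have hv x : M <= 2 * L * size (cell K n x) -> heavy K n x.
  move=> hx; apply: leq_trans hM _; apply: leq_trans (leq_mul (leqnn _) hx) _.
  by rewrite -KL; apply: eq_leq; ring.
exists i, j; split=> //; [lia | lia | exact: hv | exact: hv].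
Qed.

(** * The Turan-Kubilius inequality *)

Local Open Scope classical_set_scope.
Local Open Scope ring_scope.

Lemma sum_dvdn_reindex (V : nmodType) (F : nat -> V) d N : (0 < d)%N ->
  \sum_(1 <= n < N.+1 | (d %| n)%N) F n = \sum_(1 <= m < (N %/ d)%N.+1) F (d * m)%N.
Proof.
move=> d0; elim: N => [|N IH]; first by rewrite div0n !big_geq.
rewrite big_mkcond big_nat_recr //= -big_mkcond IH divnS //.
case: ifP => dN; last by rewrite addr0.
rewrite add1n [RHS]big_nat_recr //=; congr (_ + F _).
have -> : ((N %/ d).+1 = N.+1 %/ d)%N by rewrite divnS // dN.
by rewrite mulnC divnK.
Qed.

Lemma sum_dvdn (R : nzSemiRingType) d N : (0 < d)%N ->
  \sum_(1 <= n < N.+1) (d %| n)%N%:R = (N %/ d)%N%:R :> R.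
Proof. by move=> d0; rewrite divn_count_dvd natr_sum. Qed.

Lemma natr_divn_le (R : numDomainType) N d : (N %/ d)%N%:R * d%:R <= N%:R :> R.
Proof. by rewrite -natrM ler_nat leq_divM. Qed.

Lemma natr_divn_ge (R : numDomainType) N d : (0 < d)%N ->
  N%:R - d%:R <= (N %/ d)%N%:R * d%:R :> R.
Proof. by move=> d0; rewrite lerBlDr -natrM -natrD ler_nat; have := ltn_ceil N d0; lia. Qed.

Definition omega_sum {R : nmodType} (g : nat -> R) N : R :=
  \sum_(1 <= n < N.+1) g (num_prime_factors n).

(** The source of the shift: the multiples of p up to N are the p m with m <= N/p, and passing from
    m to p m raises Omega by one. *)
Lemma omega_sum_divp (V : nmodType) (g : nat -> V) p N : prime p ->
  omega_sum (fun k => g k.+1) (N %/ p)%N = \sum_(1 <= n < N.+1 | (p %| n)%N) g (num_prime_factors n).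
Proof.
move=> pr; rewrite sum_dvdn_reindex ?prime_gt0 // /omega_sum !big_nat.
by apply: eq_bigr => m /andP[m0 _]; rewrite num_prime_factors_mulp.
Qed.

Section TuranKubilius.
Variables (R : realFieldType) (I : eqType) (s : seq I) (q : I -> nat) (nu : I -> R).
Hypotheses (us : uniq s) (qinj : {in s &, injective q}).
Hypotheses (qprime : {in s, forall x, prime (q x)}) (nu0 : {in s, forall x, 0 <= nu x}).
Hypothesis nu1 : \sum_(x <- s) nu x = 1.

(** The factor q cancels the density 1/q of the multiples of q, so [W] has mean close to 1. *)
Let W n : R := \sum_(x <- s) (q x %| n)%N%:R * ((q x)%:R * nu x).

Lemma weighted_divisors_sum N :
  N%:R - \sum_(x <- s) (q x)%:R * nu x <= \sum_(1 <= n < N.+1) W n.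
Proof.
have -> : N%:R = \sum_(x <- s) N%:R * nu x by rewrite -mulr_sumr nu1 mulr1.
rewrite exchange_big /= -sumrB.
rewrite [leLHS]big_seq [leRHS]big_seq; apply: ler_sum => x xs.
rewrite -mulr_suml sum_dvdn ?prime_gt0 ?qprime // mulrA -mulrBl.
by apply: ler_wpM2r; rewrite ?nu0 // natr_divn_ge // prime_gt0 // qprime.
Qed.

(** Distinct primes are coprime, so the off-diagonal terms contribute at most N times the squared
    total mass; the diagonal gives the energy. Rounding down only helps in this direction, hence no
    error term. *)
Lemma weighted_divisors_sum2 N :
  \sum_(1 <= n < N.+1) W n ^+ 2 <= N%:R * (1 + \sum_(x <- s) (q x)%:R * nu x ^+ 2).
Proof.
rewrite (eq_bigr (fun n => \sum_(x <- s) \sum_(y <- s)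
   ((q x %| n) && (q y %| n))%N%:R * ((q x)%:R * (q y)%:R * (nu x * nu y)))); last first.
  move=> n _; rewrite expr2 mulr_suml; apply: eq_bigr => x _.
  by rewrite mulr_sumr; apply: eq_bigr => y _; rewrite -mulnb natrM; ring.
rewrite exchange_big /=.
have -> : N%:R * (1 + \sum_(x <- s) (q x)%:R * nu x ^+ 2) =
   \sum_(x <- s) (\sum_(y <- s) N%:R * (nu x * nu y) + N%:R * ((q x)%:R * nu x ^+ 2)).
  rewrite big_split /= -mulr_sumr mulrDr mulr1; congr (_ + _).
  under eq_bigr => x _ do rewrite -mulr_sumr -mulr_sumr nu1 mulr1.
  by rewrite -mulr_sumr nu1 mulr1.
rewrite [leLHS]big_seq [leRHS]big_seq; apply: ler_sum => x xs.
rewrite exchange_big /= (bigD1_seq x) //= addrC lerD //.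
  rewrite (bigD1_seq x) //= -[leLHS]add0r lerD ?mulr_ge0 ?nu0 ?ler0n //.
  rewrite [leLHS]big_seq_cond [leRHS]big_seq_cond; apply: ler_sum => y /andP[ys yx].
  have cop : coprime (q x) (q y).
    rewrite prime_coprime ?qprime // dvdn_prime2 ?qprime //.
    by apply: contraNneq yx => /(qinj _ _ xs ys) ->.
  under eq_bigr => n _ do rewrite -Gauss_dvd //.
  rewrite -mulr_suml sum_dvdn ?muln_gt0 ?prime_gt0 ?qprime // mulrA.
  by apply: ler_wpM2r; rewrite ?mulr_ge0 ?nu0 //; have := natr_divn_le R N (q x * q y)%N; rewrite natrM.
under eq_bigr => n _ do rewrite andbb.
rewrite -mulr_suml sum_dvdn ?prime_gt0 ?qprime //.
rewrite (_ : _ * _ = ((N %/ q x)%N%:R * (q x)%:R) * ((q x)%:R * nu x ^+ 2)); last by ring.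
by apply: ler_wpM2r; [rewrite mulr_ge0 ?sqr_ge0 | exact: natr_divn_le].
Qed.

(** The weighted sum of dilates is the sum of W(n) g(Omega(n)), so the difference is controlled by
    the variance of [W] around 1. AM-GM in place of Cauchy-Schwarz gives a bound linear in N, with a
    constant that does not depend on g. *)
Lemma turan_kubilius (tau : R) : 0 < tau ->
  \sum_(x <- s) (q x)%:R * nu x ^+ 2 <= tau ^+ 2 ->
  exists c, forall g : nat -> R, (forall k, `|g k| <= 1) -> forall N,
  `|omega_sum g N - \sum_(x <- s) (q x)%:R * nu x * omega_sum (fun k => g k.+1) (N %/ q x)%N|
     <= tau * N%:R + c.
Proof.
move=> tau0 htau; set C := \sum_(x <- s) (q x)%:R * nu x.
exists (C / tau) => g hg N.
have -> : \sum_(x <- s) (q x)%:R * nu x * omega_sum (fun k => g k.+1) (N %/ q x)%N =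
    \sum_(1 <= n < N.+1) W n * g (num_prime_factors n).
  under [RHS]eq_bigr => n _ do rewrite mulr_suml.
  rewrite [RHS]exchange_big /= [LHS]big_seq [RHS]big_seq; apply: eq_bigr => x xs.
  rewrite omega_sum_divp ?qprime // big_mkcond mulr_sumr; apply: eq_bigr => n _.
  by case: ifP => _; rewrite ?mulr0 ?mul0r // mul1r.
rewrite -sumrB; apply: le_trans (ler_norm_sum _ _ _) _.
apply: (@le_trans _ _ (\sum_(1 <= n < N.+1) (tau / 2 + (1 - W n) ^+ 2 / (2 * tau)))).
  apply: ler_sum => n _; rewrite -{1}[g _]mul1r -mulrBl normrM.
  apply: (@le_trans _ _ `|1 - W n|); first by rewrite ler_piMr.
  rewrite -subr_ge0 -[(1 - W n) ^+ 2]real_normK ?num_real //; set t := `|_|.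
  (* AM-GM: t <= tau / 2 + t^2 / (2 tau) *)
  rewrite (_ : _ - _ = (tau - t) ^+ 2 / (2 * tau)); last by field; lra.
  by rewrite divr_ge0 ?sqr_ge0 //; lra.
rewrite big_split /= sumr_const_nat subn1 /= -mulr_suml.
have -> : \sum_(1 <= n < N.+1) (1 - W n) ^+ 2 =
    N%:R - 2 * \sum_(1 <= n < N.+1) W n + \sum_(1 <= n < N.+1) W n ^+ 2.
  rewrite (eq_bigr (fun n => 1 - 2 * W n + W n ^+ 2)); last by move=> n _; ring.
  by rewrite big_split sumrB /= sumr_const_nat subn1 /= -mulr_sumr.
have h1 := weighted_divisors_sum N; have h2 := weighted_divisors_sum2 N.
rewrite -lerBrDl ler_pdivrMr; last by lra.
have N0 : 0 <= N%:R :> R by [].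
have h3 := ler_wpM2l N0 htau.
rewrite -mulr_natr (_ : (_ - _) * _ = tau ^+ 2 * N%:R + 2 * C); last by rewrite mulr_natr; field; lra.
rewrite -/C in h1; lra.
Qed.
End TuranKubilius.

(** * Averaging over the primes in cells *)

(** The N + 1 terms with N <= n <= 2N are each at least 1/(2(N + 1)), so every such block adds
    1/2. *)
Lemma harmonic_unbounded (R : archiRealFieldType) (X : R) m :
  exists N, X <= \sum_(m <= n < N) n.+1%:R^-1.
Proof.
have H k : exists N, (m <= N)%N /\ k%:R / 2 <= \sum_(m <= n < N) (n.+1%:R^-1 : R).
  elim: k => [|k [N [mN IH]]]; first by exists m; rewrite leqnn big_geq // mul0r.
  exists (N + N.+1)%N; split; first by rewrite (leq_trans mN) // leq_addr.
  rewrite (@big_cat_nat _ _ _ N) ?leq_addr //= -natr1 mulrDl lerD //.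
  apply: le_trans (_ : \sum_(N <= n < N + N.+1) (N.+1.*2)%:R^-1 <= _).
    rewrite sumr_const_nat addKn -[leRHS]mulr_natl -muln2 natrM invfM mulrA.
    by rewrite divff ?pnatr_eq0 // mul1r.
  apply: ler_sum_nat => n /andP[_ hn].
  by rewrite lef_pV2 ?posrE ?ltr0n // ler_nat; lia.
have [N [_ hN]] := H (Num.trunc (2 * X)).+1; exists N; apply: le_trans hN.
by have := truncnS_gt (2 * X); lra.
Qed.

(* Pigeonhole over the (3 K)^2 pairs of positions, against the divergent harmonic
   series. *)
Lemma uniform_heavy_cells (R : archiRealFieldType) (H : R) v s
    (r := (v.*2 + 10 + s)%N) (K := (2 ^ r)%N) :
  exists i j T, [/\ (i + 2 ^ s <= j)%N, (j < i + 2 ^ (r - v))%N, (j < 3 * K)%N &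
    [/\ uniq T, {in T, forall n, [&& r <= n, heavy K n i & heavy K n j]%N} &
     H <= \sum_(n <- T) n.+1%:R^-1 :> R]].
Proof.
set I := ('I_(3 * K) * 'I_(3 * K))%type.
pose apart (x : I) := (x.1 + 2 ^ s <= x.2)%N && (x.2 < x.1 + 2 ^ (r - v))%N.
pose good n (x : I) := heavy K n x.1 && heavy K n x.2.
have K0 : (0 < 3 * K)%N by rewrite muln_gt0 expn_gt0.
have hex n : (r <= n)%N -> exists x, apart x && good n x.
  move=> rn; have [i [j [h1 h2 h3 h4 h5]]] := two_heavy_cells_block v s n rn.
  have i3 : (i < 3 * K)%N by apply: leq_ltn_trans h3; apply: leq_trans h1; rewrite leq_addr.
  by exists (Ordinal i3, Ordinal h3); rewrite /apart /good /= h1 h2 h4 h5.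
(* If every pair of positions had mass below H, the total would be at most the number of pairs times
   |H|; the extra 1 makes this a strict contradiction. *)
have [N hN] := harmonic_unbounded R (#|{: I}|%:R * (`|H| + 1)) r.
pose F x : R := \sum_(r <= n < N | good n x) n.+1%:R^-1.
have le1 : \sum_(r <= n < N) (n.+1%:R^-1 : R) <= \sum_(x | apart x) F x.
  under [leRHS]eq_bigr => x _ do rewrite /F big_mkcond.
  rewrite exchange_big /=; apply: ler_sum_nat => n /andP[rn _].
  have [x /andP[ax gx]] := hex n rn.
  rewrite (bigD1 x) //= gx lerDl sumr_ge0 // => y _.
  by case: ifP => // _; rewrite invr_ge0.
have [/existsP[x /andP[/andP[h1 h2] hx]]|] := boolP [exists x, apart x && (H <= F x)].
  exists x.1, x.2, [seq n <- index_iota r N | good n x]; split=> //.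
  split; last by rewrite big_filter.
  - by rewrite filter_uniq ?iota_uniq.
  - move=> n; rewrite mem_filter mem_index_iota => /andP[/andP[-> ->]].
    by move=> /andP[-> _].
rewrite negb_exists => /forallP hn; exfalso.
have : \sum_(x | apart x) F x <= #|{: I}|%:R * `|H|.
  apply: le_trans (_ : \sum_(x : I) `|H| <= _); last by rewrite sumr_const mulr_natl.
  rewrite big_mkcond; apply: ler_sum => x _; case: ifP => // ax.
  by have := hn x; rewrite ax /= -ltNge => /ltW/le_trans; apply; exact: ler_norm.
have : 0 < #|{: I}|%:R :> R by rewrite ltr0n; apply/card_gt0P; exists (Ordinal K0, Ordinal K0).
move: le1 hN; lra.
Qed.

Lemma cell_bounds r n i p (K := (2 ^ r)%N) : (r <= n)%N -> p \in cell K n i ->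
  [/\ prime p, 4 ^ n %/ K * (K + i) < p & p <= 4 ^ n %/ K * (K + i).+1]%N.
Proof. by move=> rn; rewrite mem_primes_in => /and3P[]. Qed.

Lemma divnK_pow4 r n : (r <= n)%N -> (4 ^ n %/ 2 ^ r * 2 ^ r = 4 ^ n)%N.
Proof.
by move=> rn; rewrite divnK // -[4%N]/(2 ^ 2)%N -expnM dvdn_exp2l //; lia.
Qed.

Lemma cell_block r n i p : (r <= n)%N -> (i < 3 * 2 ^ r)%N ->
  p \in cell (2 ^ r) n i -> (4 ^ n < p <= 4 ^ n.+1)%N.
Proof.
move=> rn i3 /(cell_bounds _ _ _ _ rn)[_ h1 h2]; have e := divnK_pow4 _ _ rn.
rewrite expnS -e; move: h1 h2; rewrite -/(2 ^ r)%N.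
move: (4 ^ n %/ 2 ^ r)%N (2 ^ r)%N i3 => h K i3 h1 h2; apply/andP; split; nia.
Qed.

Lemma omega_sum_lip (R : realFieldType) (g : nat -> R) m n : (forall k, `|g k| <= 1) ->
  (m <= n)%N -> `|omega_sum g n - omega_sum g m| <= n%:R - m%:R.
Proof.
move=> hg mn; rewrite /omega_sum (@big_cat_nat _ _ _ m.+1 1 n.+1) //= addrC addrA addNr add0r.
apply: le_trans (ler_norm_sum _ _ _) _.
apply: le_trans (_ : \sum_(m.+1 <= k < n.+1) 1 <= _); first exact: ler_sum.
by rewrite sumr_const_nat subSS natrB.
Qed.

Lemma omega_sum_norm (R : realFieldType) (g : nat -> R) n : (forall k, `|g k| <= 1) ->
  `|omega_sum g n| <= n%:R.
Proof.
move=> hg; have := omega_sum_lip _ _ 0 n hg (leq0n n).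
by rewrite {2}/omega_sum big_geq // !subr0.
Qed.

(** This replaces p by the left end h k of its cell. The cell has relative width 1/k, so the error
    for k M is of order M. *)
Lemma omega_sum_divn_cmp (R : realFieldType) (g : nat -> R) h k p M :
  (forall k, `|g k| <= 1) -> (0 < h * k)%N -> (h * k < p)%N -> (p <= h * k.+1)%N ->
  `|p%:R * omega_sum g (k * M %/ p) - (k * h)%:R * omega_sum g (M %/ h)| <= 2 * M%:R + p%:R.
Proof.
move=> hg; rewrite muln_gt0 => /andP[h0 k0] zp pz.
have p0 : (0 < p)%N by apply: leq_ltn_trans zp.
set a := (k * M %/ p)%N; set b := (M %/ h)%N.
have ab : (a <= b)%N.
  rewrite /b -(divnMl k0) leq_div2l ?muln_gt0 ?k0 //; lia.
have ha := ltn_ceil (k * M) p0; have hb := leq_divM M h.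
(* With b >= a this says p (b - a) + (p - k h) b <= 2 M + p, which is the total error below. *)
have h1 : (2 * p * b <= p * a + k * h * b + 2 * M + p)%N.
  have : (b * p <= b * (k * h) + b * h)%N by rewrite -mulnDr leq_mul2l; lia.
  have : (k * (b * h) <= k * M)%N by rewrite leq_mul2l hb orbT.
  move: ha hb; rewrite -/a -/b; clear; lia.
have := omega_sum_lip _ _ _ _ hg ab; have := omega_sum_norm _ _ b hg.
move: (omega_sum g a) (omega_sum g b) => Sa Sb nb nab.
have -> : p%:R * Sa - (k * h)%:R * Sb = p%:R * (Sa - Sb) + (p%:R - (k * h)%:R) * Sb by ring.
apply: le_trans (ler_normD _ _) _; rewrite !normrM distrC (ger0_norm (ler0n _ _)).
rewrite ger0_norm; last by rewrite subr_ge0 ler_nat; lia.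
apply: le_trans (lerD (ler_wpM2l (ler0n _ _) nab) (ler_wpM2l _ nb)) _.
  by rewrite subr_ge0 ler_nat; lia.
move: h1; rewrite -(ler_nat R) !(natrM, natrD); lra.
Qed.

Section CellAverage.
Variables (R : realFieldType) (r i : nat) (T : seq nat).
Local Notation K := (2 ^ r)%N.
Hypotheses (i3 : (i < 3 * K)%N) (uT : uniq T).
Hypothesis hT : {in T, forall n, (r <= n)%N && heavy K n i}.

Let Hs : R := \sum_(n <- T) n.+1%:R^-1.
Hypothesis Hs0 : 0 < Hs.

Let w n : R := n.+1%:R^-1 / Hs.

Definition cell_primes := [seq (n, p) | n <- T, p <- cell K n i].
Definition cell_weight (x : nat * nat) : R := w x.1 / (size (cell K x.1 i))%:R.

Lemma mem_cell_primes n p : (n, p) \in cell_primes -> n \in T /\ p \in cell K n i.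
Proof. by move=> /allpairsPdep[n' [p' [h1 h2 [-> ->]]]]. Qed.

Lemma cell_primes_uniq : uniq cell_primes.
Proof.
apply: allpairs_uniq_dep => //; first by move=> n _; exact: primes_in_uniq.
by move=> [n p] [n' p'] _ _ /= [-> ->].
Qed.

(** The blocks (4^n, 4^(n+1)] are disjoint, so a prime determines its n. *)
Lemma cell_primes_inj : {in cell_primes &, injective (fun x => x.2)}.
Proof.
move=> [n p] [n' p'] /mem_cell_primes[nT pn] /mem_cell_primes[n'T pn'] /= e.
move: pn' pn; rewrite -e.
have /andP[rn _] := hT _ nT; have /andP[rn' _] := hT _ n'T.
move=> /(cell_block _ _ _ _ rn' i3)/andP[a1 a2] /(cell_block _ _ _ _ rn i3)/andP[b1 b2].
have := leq_trans a1 b2; have := leq_trans b1 a2; rewrite !ltn_exp2l //.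
by move=> h1 h2; congr (_, _); lia.
Qed.

Lemma cell_primes_prime : {in cell_primes, forall x, prime x.2}.
Proof.
move=> [n p] /mem_cell_primes[nT pn] /=; have /andP[rn _] := hT _ nT.
by have [] := cell_bounds _ _ _ _ rn pn.
Qed.

Lemma size_cell_gt0 n : n \in T -> (0 < size (cell K n i))%N.
Proof.
move=> nT; have /andP[_] := hT _ nT; rewrite /heavy; case: size => //.
by rewrite muln0 leqn0 expn_eq0.
Qed.

Lemma w_ge0 n : 0 <= w n.
Proof. by rewrite divr_ge0 ?invr_ge0 // ltW. Qed.

Lemma cell_weight_ge0 x : 0 <= cell_weight x.
Proof. by rewrite divr_ge0 ?w_ge0. Qed.

Lemma sum_cell_weight (F : nat -> R) :
  \sum_(x <- cell_primes) cell_weight x * F x.1 = \sum_(n <- T) w n * F n.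
Proof.
rewrite big_allpairs_dep [LHS]big_seq [RHS]big_seq; apply: eq_bigr => n nT.
rewrite /cell_weight /= big_const_seq count_predT iter_addr_0 -mulr_natr.
by field; rewrite pnatr_eq0 -lt0n size_cell_gt0.
Qed.

Lemma sum_w : \sum_(n <- T) w n = 1.
Proof. by rewrite -mulr_suml divff // gt_eqF. Qed.

Lemma sum_cell_weight1 : \sum_(x <- cell_primes) cell_weight x = 1.
Proof.
have := sum_cell_weight (fun=> 1); under eq_bigr => x _ do rewrite mulr1.
by under [in RHS]eq_bigr => x _ do rewrite mulr1; rewrite sum_w.
Qed.

(** A heavy cell has at least 4^n / (12 K (n+1)) primes p <= 4^(n+1), so p times its weight is at
    most 48 K (n+1) w(n). The harmonic choice of w makes this 48 K / Hs for every n. *)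
Lemma cell_weight_energy :
  \sum_(x <- cell_primes) x.2%:R * cell_weight x ^+ 2 <= 48 * K%:R / Hs.
Proof.
rewrite [leRHS](_ : _ = \sum_(n <- T) w n * (48 * K%:R / Hs)); last first.
  by rewrite -mulr_suml sum_w mul1r.
rewrite -(sum_cell_weight (fun=> _)) [leLHS]big_seq [leRHS]big_seq.
apply: ler_sum => -[n p] hx; rewrite expr2 mulrCA; apply: ler_wpM2l; first exact: cell_weight_ge0.
have [nT pn] := mem_cell_primes _ _ hx; have /andP[rn hv] := hT _ nT.
have c0 := size_cell_gt0 _ nT; have /andP[_ pb] := cell_block _ _ _ _ rn i3 pn.
rewrite /cell_weight /w /=.
have {hv} : (p <= 48 * K * n.+1 * size (cell K n i))%N.
  by rewrite (leq_trans pb) // expnS; move: hv; rewrite /heavy; lia.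
rewrite -(ler_nat R) !natrM => hp.
rewrite [leLHS](_ : _ = p%:R / (n.+1%:R * (size (cell K n i))%:R) / Hs); last first.
  by field; rewrite gt_eqF // nat1r !pnatr_eq0 -lt0n c0.
apply: ler_wpM2r; first by rewrite invr_ge0 ltW.
by rewrite ler_pdivrMr ?mulr_gt0 ?ltr0n // mulrA.
Qed.

Lemma cell_turan_kubilius (tau : R) : 0 < tau -> 48 * K%:R / Hs <= tau ^+ 2 ->
  exists c, forall g : nat -> R, (forall k, `|g k| <= 1) -> forall N,
  `|omega_sum g N - \sum_(x <- cell_primes)
       x.2%:R * cell_weight x * omega_sum (fun k => g k.+1) (N %/ x.2)| <= tau * N%:R + c.
Proof.
move=> tau0 ht; apply: turan_kubilius => //.
- exact: cell_primes_uniq.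
- exact: cell_primes_inj.
- exact: cell_primes_prime.
- by move=> x _; exact: cell_weight_ge0.
- exact: sum_cell_weight1.
by apply: le_trans ht; exact: cell_weight_energy.
Qed.
(** A prime of cell i is close to (K + i) h with h = 4^n / K, so (K + i) M / p is close to M / h,
    where i has disappeared. The 6 M consists of 2 M for this replacement and 4 M from
    Turan-Kubilius with tau = 1/K, because K + i < 4 K. *)
Lemma cell_average : 48 * K%:R / Hs <= K%:R^-1 ^+ 2 ->
  exists c, forall g : nat -> R, (forall k, `|g k| <= 1) -> forall M,
  `|omega_sum g ((K + i) * M) - \sum_(n <- T)
       w n * (((K + i) * (4 ^ n %/ K))%:R * omega_sum (fun k => g k.+1) (M %/ (4 ^ n %/ K)))|
     <= 6 * M%:R + c.
Proof.
have K0 : 0 < K%:R :> R by rewrite ltr0n expn_gt0.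
have iK : 0 < K%:R^-1 :> R by rewrite invr_gt0.
move=> /(cell_turan_kubilius _ iK)[c hc].
exists (c + \sum_(x <- cell_primes) cell_weight x * x.2%:R) => g hg M.
set g' := fun k => g k.+1; have hg' k : `|g' k| <= 1 by exact: hg.
rewrite -(sum_cell_weight (fun n => ((K + i) * (4 ^ n %/ K))%:R * omega_sum g' (M %/ (4 ^ n %/ K)))).
have := hc g hg ((K + i) * M)%N; rewrite -/g'; set A := omega_sum g _.
set B := \sum_(x <- _) _ * _ * _; set C := \sum_(x <- _) _ * (_ * _).
move=> h1; have h2 : `|B - C| <= 2 * M%:R + \sum_(x <- cell_primes) cell_weight x * x.2%:R.
  have -> : 2 * M%:R = \sum_(x <- cell_primes) cell_weight x * (2 * M%:R) :> R.
    by rewrite -mulr_suml sum_cell_weight1 mul1r.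
  rewrite -big_split -sumrB /=.
  apply: le_trans (ler_norm_sum _ _ _) _; rewrite [leLHS]big_seq [leRHS]big_seq.
  apply: ler_sum => -[n p] /mem_cell_primes[nT pn] /=.
  have /andP[rn _] := hT _ nT; have [_ zp pz] := cell_bounds _ _ _ _ rn pn.
  rewrite -mulrDr mulrAC [_ * cell_weight _]mulrC -mulrBr normrM.
  rewrite ger0_norm ?cell_weight_ge0 //; apply: ler_wpM2l; first exact: cell_weight_ge0.
  apply: omega_sum_divn_cmp => //; rewrite muln_gt0 addn_gt0 expn_gt0 /= andbT.
  have := divnK_pow4 _ _ rn; case: (4 ^ n %/ K)%N => // e.
  by move: (expn_gt0 4 n); rewrite -e mul0n.
have h3 : K%:R^-1 * ((K + i) * M)%:R <= 4 * M%:R :> R.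
  by rewrite mulrC ler_pdivrMr // -!natrM ler_nat; nia.
have -> : A - C = (A - B) + (B - C) by ring.
by apply: le_trans (ler_normD _ _) _; lra.
Qed.
End CellAverage.

(** * Invariance of the mean under dilations *)

Lemma exists_pow2_ge (R : archiRealFieldType) (x : R) : exists v, x <= (2 ^ v)%:R.
Proof.
exists (Num.trunc x).+1; apply: le_trans (ltW (truncnS_gt x)) _.
by rewrite ler_nat ltnW // ltn_expl.
Qed.

Lemma bernoulli (R : realFieldType) (t : R) n : 0 <= t -> 1 + n%:R * t <= (1 + t) ^+ n.
Proof.
move=> t0; elim: n => [|n IH]; first by rewrite expr0 mul0r addr0.
rewrite exprS; apply: le_trans (ler_wpM2l _ IH); last by lra.
rewrite -natr1; have : 0 <= n%:R * t * t by rewrite !mulr_ge0.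
lra.
Qed.

Lemma prime_average (R : archiRealFieldType) (tau : R) : 0 < tau ->
  exists (s : seq (nat * nat)) (nu : nat * nat -> R),
  [/\ {in s, forall x, prime x.2}, forall x, 0 <= nu x, \sum_(x <- s) nu x = 1 &
  exists c, forall g : nat -> R, (forall k, `|g k| <= 1) -> forall N,
  `|omega_sum g N - \sum_(x <- s) x.2%:R * nu x * omega_sum (fun k => g k.+1) (N %/ x.2)|
     <= tau * N%:R + c].
Proof.
(* One cell position is enough here, so v = s = 0; only the harmonic mass has to be large in terms
   of tau. *)
move=> tau0; pose r := (0.*2 + 10 + 0)%N.
have K0 : 0 < (2 ^ r)%:R :> R by rewrite ltr0n expn_gt0.
have H0 : 0 < 48 * (2 ^ r)%:R / tau ^+ 2 :> R by rewrite divr_gt0 ?mulr_gt0 ?exprn_gt0.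
have [i [j [T [h1 h2 h3 [uT hT hH]]]]] := uniform_heavy_cells R (48 * (2 ^ r)%:R / tau ^+ 2) 0 0.
have Hs0 := lt_le_trans H0 hH.
have i3 : (i < 3 * 2 ^ r)%N by apply: leq_ltn_trans h3; apply: leq_trans h1; rewrite leq_addr.
have hTi : {in T, forall n, (r <= n)%N && heavy (2 ^ r) n i}.
  by move=> n /hT /and3P[-> ->].
exists (cell_primes r i T), (cell_weight R r i T); split.
- exact: cell_primes_prime.
- exact: cell_weight_ge0.
- exact: sum_cell_weight1.
apply: cell_turan_kubilius => //.
by rewrite ler_pdivrMr // -ler_pdivrMl ?exprn_gt0 // [leLHS]mulrC.
Qed.

(** Take A = K + i and B = K + j. After division by A or B both cell averages become the same
    quantity [Psi], each with error 6 M / K up to a constant. *)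
Lemma close_ratio (R : archiRealFieldType) (eps : R) : 0 < eps ->
  exists A B : nat, [/\ (0 < A < B)%N, B%:R - A%:R <= eps * A%:R &
  exists c, forall g : nat -> R, (forall k, `|g k| <= 1) -> forall M,
  `|omega_sum g (A * M) / A%:R - omega_sum g (B * M) / B%:R|
     <= eps * ((B%:R - A%:R) / A%:R) * M%:R + c].
Proof.
(* [v] makes the gap (j - i)/(K + i) at most eps. Since K + i < 4 K, the gap is at least 2^s / (4
   K), so 2^s >= 48 / eps makes the total error 12 / K at most eps times the gap. *)
move=> e0; have [v hv] := exists_pow2_ge R eps^-1; have [s hs] := exists_pow2_ge R (48 / eps).
pose r := (v.*2 + 10 + s)%N; pose K := (2 ^ r)%N.
have K0 : 0 < K%:R :> R by rewrite ltr0n expn_gt0.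
have H0 : 0 < 48 * K%:R ^+ 3 :> R by rewrite mulr_gt0 ?exprn_gt0.
(* Harmonic mass 48 K^3 brings the energy 48 K / Hs down to K^-2, as [cell_average] requires. *)
have [i [j [T [h1 h2 h3 [uT hT hH]]]]] := uniform_heavy_cells R (48 * K%:R ^+ 3) v s.
rewrite -/r -/K in h2 h3 hT.
have Hs0 := lt_le_trans H0 hH.
have i3 : (i < 3 * K)%N by apply: leq_ltn_trans h3; apply: leq_trans h1; rewrite leq_addr.
have hTi : {in T, forall n, (r <= n)%N && heavy K n i} by move=> n /hT /and3P[-> ->].
have hTj : {in T, forall n, (r <= n)%N && heavy K n j} by move=> n /hT /and3P[-> _ ->].
have hE : 48 * K%:R / (\sum_(n <- T) n.+1%:R^-1) <= K%:R^-1 ^+ 2 :> R.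
  rewrite ler_pdivrMr // exprVn -ler_pdivrMl ?invr_gt0 ?exprn_gt0 // invrK.
  by apply: le_trans hH; rewrite le_eqVlt; apply/orP; left; apply/eqP; ring.
have [ci hi] := cell_average R r i T i3 uT hTi Hs0 hE.
have [cj hj] := cell_average R r j T h3 uT hTj Hs0 hE.
have s0 : (0 < 2 ^ s)%N by rewrite expn_gt0.
have Kn : (0 < K)%N by rewrite expn_gt0.
have lij : (i < j)%N by apply: leq_trans h1; rewrite -addn1 leq_add2l.
have ij := ltnW lij.
have gap : (K + j)%:R - (K + i)%:R = (j - i)%:R :> R.
  by rewrite !natrD natrB //; ring.
have A0 : 0 < (K + i)%:R :> R by rewrite ltr0n addn_gt0 Kn.
exists (K + i)%N, (K + j)%N; split.
- by rewrite addn_gt0 Kn /= ltn_add2l.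
- have : (2 ^ v * (j - i) <= K)%N.
    rewrite -[K](_ : 2 ^ v * 2 ^ (r - v) = _)%N; last first.
      by rewrite -expnD subnKC // /r -addnn -!addnA leq_addr.
    by rewrite leq_mul2l leq_subLR ltnW ?orbT.
  rewrite gap mulrC -ler_pdivrMr // mulrC -(ler_nat R) natrM => /(le_trans (ler_wpM2r (ler0n _ _) hv)).
  by move=> /le_trans; apply; rewrite ler_nat leq_addr.
exists (`|ci| + `|cj|) => g hg M; rewrite gap.
pose Psi : R := \sum_(n <- T) n.+1%:R^-1 / (\sum_(n <- T) n.+1%:R^-1) *
  ((4 ^ n %/ K)%:R * omega_sum (fun k => g k.+1) (M %/ (4 ^ n %/ K))).
have near k c : `|omega_sum g ((K + k) * M) - \sum_(n <- T)
       n.+1%:R^-1 / (\sum_(n <- T) n.+1%:R^-1) *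
        (((K + k) * (4 ^ n %/ K))%:R * omega_sum (fun k => g k.+1) (M %/ (4 ^ n %/ K)))|
     <= 6 * M%:R + c -> `|omega_sum g ((K + k) * M) / (K + k)%:R - Psi| <= 6 * M%:R / K%:R + `|c|.
  have k0 : 0 < (K + k)%:R :> R by rewrite ltr0n addn_gt0 Kn.
  have kK : K%:R <= (K + k)%:R :> R by rewrite ler_nat leq_addr.
  have k1 : 1 <= (K + k)%:R :> R by rewrite ler1n addn_gt0 Kn.
  have -> : \sum_(n <- T) n.+1%:R^-1 / (\sum_(n <- T) n.+1%:R^-1) *
        (((K + k) * (4 ^ n %/ K))%:R * omega_sum (fun k => g k.+1) (M %/ (4 ^ n %/ K)))
      = (K + k)%:R * Psi.
    by rewrite mulr_sumr; apply: eq_bigr => n _; rewrite natrM; ring.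
  move=> h; have -> : omega_sum g ((K + k) * M) / (K + k)%:R - Psi =
      (omega_sum g ((K + k) * M) - (K + k)%:R * Psi) / (K + k)%:R.
    by rewrite mulrBl mulrAC divff ?gt_eqF // mul1r.
  rewrite normrM normfV (gtr0_norm k0) ler_pdivrMr //; apply: le_trans h _.
  rewrite [leRHS]mulrDl; apply: lerD.
    by rewrite -[leRHS]mulrA ler_peMr ?mulr_ge0 // ler_pdivlMl // mulr1.
  by apply: le_trans (ler_norm _) _; rewrite ler_peMr.
have := near j cj (hj g hg M); have := near i ci (hi g hg M).
have : 12 / K%:R <= eps * ((j - i)%:R / (K + i)%:R).
  rewrite mulrA ler_pdivlMr // mulrAC ler_pdivrMr //.
  apply: le_trans (_ : 48 * K%:R <= _).
    by have := i3; rewrite -(ltr_nat R) natrM natrD; lra.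
  rewrite ler_wpM2r //; move: hs; rewrite ler_pdivrMr // => /le_trans; apply.
  by rewrite [leLHS]mulrC ler_pM2l // ler_nat leq_subRL.
move=> /(ler_wpM2r (ler0n _ M)); rewrite (_ : 12 / K%:R * M%:R = 2 * (6 * M%:R / K%:R)); last by ring.
rewrite !ler_norml => ? /andP[? ?] /andP[? ?]; lra.
Qed.

(* The factor rho - 1 in the error is what makes the step iterable: reaching a
   fixed dilation takes about 1 / (rho - 1) steps. *)
Lemma omega_sum_step (R : archiRealFieldType) (eps : R) : 0 < eps ->
  exists2 rho, 1 < rho <= 1 + eps &
  exists c, forall g : nat -> R, (forall k, `|g k| <= 1) -> forall x, 0 <= x ->
  `|omega_sum g (Num.trunc (rho * x)) - rho * omega_sum g (Num.trunc x)|
     <= rho * (eps * (rho - 1)) * x + c.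
Proof.
move=> e0; have [A [B [/andP[A0 AB] hAB [c hc]]]] := close_ratio R eps e0.
have A0' : 0 < A%:R :> R by rewrite ltr0n.
have B0' : 0 < B%:R :> R by rewrite ltr0n (leq_ltn_trans _ AB).
set rho : R := B%:R / A%:R; have rA : rho * A%:R = B%:R by rewrite /rho divfK ?gt_eqF.
have rho1 : 1 < rho by rewrite /rho ltr_pdivlMr // mul1r ltr_nat.
exists rho; first by rewrite rho1 /rho ler_pdivrMr //; lra.
exists (B%:R + B%:R * c + rho * A%:R) => g hg x x0.
(* With this [M], x is within A of A M and rho x within B of B M, so rounding costs only
   constants. *)
set M := Num.trunc (x / A%:R).
have /andP[m1 m2] := truncn_itv (divr_ge0 x0 (ltW A0')); rewrite -/M in m1 m2.
have {}m1 : A%:R * M%:R <= x by rewrite mulrC -ler_pdivlMr.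
have {}m2 : x < A%:R * M%:R + A%:R by move: m2; rewrite ltr_pdivrMr // -natr1; lra.
have near C (y : R) : 0 <= y -> C%:R * M%:R <= y -> y < C%:R * M%:R + C%:R ->
    `|omega_sum g (Num.trunc y) - omega_sum g (C * M)| <= C%:R.
  move=> y0 l1 l2; have le : (C * M <= Num.trunc y)%N by rewrite truncn_ge_nat // natrM.
  apply: le_trans (omega_sum_lip _ _ _ _ hg le) _.
  by have : (Num.trunc y)%:R <= y; [rewrite truncn_le | rewrite natrM; lra].
have rx0 : 0 <= rho * x by rewrite mulr_ge0 //; lra.
have h1 := near A x x0 m1 m2.
have h2 : `|omega_sum g (Num.trunc (rho * x)) - omega_sum g (B * M)| <= B%:R.
  have r0 : 0 < rho by lra.
  apply: near => //; first by rewrite -rA -mulrA ler_pM2l.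
  by have := m2; rewrite -(ltr_pM2l r0) mulrDr mulrA rA.
have h3 := hc g hg M.
have h4 : `|omega_sum g (B * M) - rho * omega_sum g (A * M)| <=
     B%:R * (eps * (rho - 1) * M%:R + c).
  have -> : omega_sum g (B * M) - rho * omega_sum g (A * M) =
     - B%:R * (omega_sum g (A * M) / A%:R - omega_sum g (B * M) / B%:R).
    by rewrite /rho; field; rewrite !gt_eqF.
  rewrite normrM normrN normr_nat; apply: ler_wpM2l; first exact: ler0n.
  apply: le_trans h3 _; rewrite (_ : (B%:R - A%:R) / A%:R = rho - 1) // /rho.
  by field; rewrite gt_eqF.
have h5 : B%:R * M%:R * (eps * (rho - 1)) <= rho * x * (eps * (rho - 1)).
  apply: ler_wpM2r; first by rewrite mulr_ge0; lra.
  by rewrite -rA -mulrA ler_wpM2l //; lra.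
have h6 : `|rho * (omega_sum g (A * M) - omega_sum g (Num.trunc x))| <= rho * A%:R.
  by rewrite normrM distrC ger0_norm; [apply: ler_wpM2l => //; lra | lra].
move: h2 h4 h6; move: (omega_sum g _) (omega_sum g _) (omega_sum g _) (omega_sum g _) => a b d e.
rewrite !ler_norml => /andP[? ?] /andP[? ?] /andP[? ?]; lra.
Qed.

(** Relative to the dilated argument each step costs eps (rho - 1), and these costs add up. *)
Lemma omega_sum_iter (R : archiRealFieldType) (eps rho c : R) r : 0 < eps -> 1 < rho ->
  (forall g : nat -> R, (forall k, `|g k| <= 1) -> forall x, 0 <= x ->
  `|omega_sum g (Num.trunc (rho * x)) - rho * omega_sum g (Num.trunc x)|
     <= rho * (eps * (rho - 1)) * x + c) ->
  exists c', forall g : nat -> R, (forall k, `|g k| <= 1) -> forall x, 0 <= x ->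
  `|omega_sum g (Num.trunc (rho ^+ r * x)) - rho ^+ r * omega_sum g (Num.trunc x)|
     <= rho ^+ r * (r%:R * (eps * (rho - 1))) * x + c'.
Proof.
move=> e0 rho1 hc; elim: r => [|r [c' IH]].
  by exists 0 => g hg x x0; rewrite expr0 !mul1r subrr normr0 !mul0r addr0.
exists (c + rho * c') => g hg x x0.
have y0 : 0 <= rho ^+ r * x by rewrite mulr_ge0 ?exprn_ge0 //; lra.
have := hc g hg _ y0; have := IH g hg x x0.
rewrite [rho * (rho ^+ r * x)]mulrA -exprS; set a := omega_sum g _; set b := omega_sum g _; set d := omega_sum g _.
move=> h1 h2.
have -> : d - rho ^+ r.+1 * b = (d - rho * a) + rho * (a - rho ^+ r * b) by rewrite exprS; ring.
apply: le_trans (ler_normD _ _) _; rewrite normrM [`|rho|]ger0_norm; last by lra.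
apply: le_trans (lerD h2 (ler_wpM2l _ h1)) _; first by lra.
by rewrite -natr1 exprS le_eqVlt; apply/orP; left; apply/eqP; ring.
Qed.

(** Choose r with rho^r <= L < rho^(r+1). Bernoulli's inequality bounds r (rho - 1) by rho^r <= L,
    so the accumulated error is at most L^2 [del] M up to a constant. *)
Lemma omega_sum_dilate (R : archiRealFieldType) (eps : R) L : 0 < eps -> (0 < L)%N ->
  exists c, forall g : nat -> R, (forall k, `|g k| <= 1) -> forall M,
  `|omega_sum g (L * M) - L%:R * omega_sum g M| <= eps * M%:R + c.
Proof.
move=> e0 L0; have L1 : 1 <= L%:R :> R by rewrite ler1n.
have D0 : 0 < L%:R * L%:R + 2 * L%:R :> R by apply: addr_gt0; rewrite mulr_gt0 //; lra.
(* The term L * L pays for the iteration. The term 2 * L pays for replacing rho^r by L, once in the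
   argument of the sum and once in its factor. *)
set del := eps / (L%:R * L%:R + 2 * L%:R).
have d0 : 0 < del by rewrite divr_gt0.
have [rho /andP[r1 r2] [c0 hc0]] := omega_sum_step R del d0.
have ex : exists n, L%:R < rho ^+ n.
  exists (Num.trunc (L%:R / (rho - 1))).+1.
  have -> : rho = 1 + (rho - 1) by ring.
  have rr : 0 < rho - 1 by lra.
  apply: lt_le_trans (bernoulli _ _ _ (ltW rr)).
  have := truncnS_gt (L%:R / (rho - 1)); rewrite ltr_pdivrMr //.
  by rewrite (_ : 1 + (rho - 1) - 1 = rho - 1); last ring; move: (_.+1%:R * _) => z; lra.
case: (ex_minnP ex) => -[|r]; first by rewrite expr0 ltNge L1.
move=> hr /(_ r) rmin; have {rmin} hr' : rho ^+ r <= L%:R.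
  by rewrite leNgt; apply/negP => /rmin; rewrite ltnn.
have [c1 hc1] := omega_sum_iter _ _ _ _ r d0 r1 hc0.
exists (c1 + 1) => g hg M; have M0 := ler0n R M.
have := hc1 g hg _ M0; rewrite natrK.
have rr0 : 0 <= rho ^+ r by rewrite exprn_ge0 //; lra.
have rM0 : 0 <= rho ^+ r * M%:R by rewrite mulr_ge0.
have le : (Num.trunc (rho ^+ r * M%:R) <= L * M)%N.
  by rewrite -(ler_nat R) natrM (le_trans (_ : _ <= rho ^+ r * M%:R)) ?truncn_le // ler_wpM2r.
have h1 := omega_sum_lip _ _ _ _ hg le.
have h2 := omega_sum_norm _ _ M hg.
have /andP[_ t2] := truncn_itv rM0; rewrite -natr1 in t2; rewrite natrM in h1.
have gap : L%:R - rho ^+ r <= L%:R * del.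
  apply: le_trans (_ : rho ^+ r * (rho - 1) <= _); first by rewrite exprSr in hr; lra.
  apply: le_trans (_ : L%:R * (rho - 1) <= _); first by rewrite ler_wpM2r //; lra.
  by rewrite ler_wpM2l //; lra.
have h3 : rho ^+ r * (r%:R * (del * (rho - 1))) <= L%:R * L%:R * del.
  have := bernoulli R (rho - 1) r; rewrite (_ : 1 + (rho - 1) = rho); last by ring.
  move=> /(_ ltac:(lra)) hb; rewrite (_ : _ * _ = rho ^+ r * (r%:R * (rho - 1)) * del); last by ring.
  apply: ler_wpM2r; first exact: ltW.
  apply: ler_pM => //; first by rewrite mulr_ge0 //; lra.
  lra.
have h4 : `|(L%:R - rho ^+ r) * omega_sum g M| <= L%:R * del * M%:R.
  by rewrite normrM ler_pM // ger0_norm ?subr_ge0.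
have e : eps = L%:R * L%:R * del + 2 * (L%:R * del) by rewrite /del; field; rewrite gt_eqF.
have h5 := ler_wpM2r M0 h3; have h6 := ler_wpM2r M0 gap.
rewrite e; move: h1 h4 h5 h6 t2; clear -L1.
move: (omega_sum g _) (omega_sum g _) (omega_sum g _) => a b d.
rewrite !ler_norml => /andP[? ?] /andP[? ?] ? ? ? /andP[? ?]; lra.
Qed.

(** * Invariance under the shift by one *)

Lemma omega_sum_dilate_seq (R : archiRealFieldType) (eps : R) (s : seq nat) : 0 < eps ->
  {in s, forall p, 0 < p}%N ->
  exists c, forall g : nat -> R, (forall k, `|g k| <= 1) -> {in s, forall L M,
  `|omega_sum g (L * M) - L%:R * omega_sum g M| <= eps * M%:R + c}.
Proof.
move=> e0; elim: s => [|L s IH] hs; first by exists 0.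
have [c1 h1] := IH (fun p ps => hs p (mem_behead (s := L :: s) ps)).
have [c2 h2] := omega_sum_dilate R eps L e0 (hs L (mem_head _ _)).
exists (Num.max c1 c2) => g hg p; rewrite inE => /orP[/eqP -> M | ps M].
  by apply: le_trans (h2 g hg M) _; rewrite lerD2l le_max lexx orbT.
by apply: le_trans (h1 g hg p ps M) _; rewrite lerD2l le_max lexx.
Qed.

(** Turan-Kubilius writes S(N) as an average of p S'(N/p), and dilation invariance over the finitely
    many primes p involved turns each p S'(N/p) into S'(N). *)
Lemma omega_sum_shift (R : archiRealFieldType) (eps : R) : 0 < eps ->
  exists c, forall g : nat -> R, (forall k, `|g k| <= 1) -> forall N,
  `|omega_sum (fun k => g k.+1) N - omega_sum g N| <= eps * N%:R + c.
Proof.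
move=> e0; have e2 : 0 < eps / 2 by lra.
have [s [nu [sp nu0 nu1 [c hc]]]] := prime_average R (eps / 2) e2.
have hs : {in [seq x.2 | x <- s], forall p, 0 < p}%N.
  by move=> _ /mapP[x /sp/prime_gt0 x0 ->].
have [d hd] := omega_sum_dilate_seq R (eps / 2) _ e2 hs.
exists (c + d + \sum_(x <- s) nu x * x.2%:R) => g hg N.
set g' := fun k => g k.+1; have hg' k : `|g' k| <= 1 by exact: hg.
have := hc g hg N; rewrite -/g'; set B := \sum_(x <- _) _ * _ * _ => h1.
have h2 : `|omega_sum g' N - B| <= eps / 2 * N%:R + d + \sum_(x <- s) nu x * x.2%:R.
  have avg (y : R) : y = \sum_(x <- s) nu x * y by rewrite -mulr_suml nu1 mul1r.
  rewrite [omega_sum g' N]avg [eps / 2 * N%:R + d]avg -big_split -sumrB /=.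
  apply: le_trans (ler_norm_sum _ _ _) _; rewrite [leLHS]big_seq [leRHS]big_seq.
  apply: ler_sum => x xs; have x0 := prime_gt0 (sp x xs).
  rewrite -mulrDr mulrAC [_ * nu x]mulrC -mulrBr normrM.
  rewrite ger0_norm ?nu0 //; apply: ler_wpM2l => //.
  set M := (N %/ x.2)%N.
  have le : (x.2 * M <= N)%N by rewrite mulnC leq_divM.
  have h3 := omega_sum_lip _ _ _ _ hg' le.
  have h4 := hd g' hg' x.2 (map_f _ xs) M.
  have h5 : N%:R - x.2%:R <= x.2%:R * M%:R :> R.
    by rewrite [leRHS]mulrC natr_divn_ge.
  have h6 : eps / 2 * M%:R <= eps / 2 * N%:R by rewrite ler_pM2l // ler_nat leq_div.
  move: h3 h4; rewrite natrM.
  rewrite !ler_norml => /andP[? ?] /andP[? ?]; lra.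
move: h1 h2; rewrite !ler_norml => /andP[? ?] /andP[? ?]; lra.
Qed.

Lemma omega_sum_shift_small (R : archiRealFieldType) (g : nat -> R) (B e : R) :
  (forall k, `|g k| <= B) -> 0 < e ->
  exists N0, forall N, (N0 <= N)%N ->
  `|omega_sum (fun k => g k.+1) N - omega_sum g N| <= e * N%:R.
Proof.
move=> hg e0; have B0 : 0 <= B := le_trans (normr_ge0 _) (hg 0%N).
(* Normalising by B + 1 avoids division by zero when B = 0. *)
have B1 : 0 < B + 1 by lra.
have d0 : 0 < e / (2 * (B + 1)) by rewrite divr_gt0 // mulr_gt0.
have [c hc] := omega_sum_shift R _ d0.
(* The linear term uses e/2 per unit of N; from this N on, the constant (B + 1) c fits into the
   other half. *)
exists (Num.trunc (2 * ((B + 1) * c) / e)).+1 => N hN.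
have scale (h : nat -> R) : omega_sum (fun k => h k / (B + 1)) N = omega_sum h N / (B + 1).
  by rewrite /omega_sum -mulr_suml.
have hg1 k : `|g k / (B + 1)| <= 1.
  by rewrite normrM normfV (gtr0_norm B1) ler_pdivrMr // mul1r; have := hg k; lra.
have := hc (fun k => g k / (B + 1)) hg1 N; rewrite !scale -mulrBl normrM normfV (gtr0_norm B1).
rewrite ler_pdivrMr // => /le_trans; apply.
have -> : (e / (2 * (B + 1)) * N%:R + c) * (B + 1) = e * N%:R / 2 + (B + 1) * c.
  by field; rewrite gt_eqF.
have : 2 * ((B + 1) * c) / e <= N%:R.
  by apply: le_trans (ltW (truncnS_gt _)) _; rewrite ler_nat.
rewrite ler_pdivrMr //; lra.
Qed.

(** * From real to complex values *)

Local Open Scope complex_scope.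

Lemma Re_real_mul (R : realType) (x : R) (z : R[i]) : complex.Re (x%:C * z) = x * complex.Re z.
Proof. by case: z => a b /=; rewrite mul0r subr0. Qed.

Lemma Im_real_mul (R : realType) (x : R) (z : R[i]) : complex.Im (x%:C * z) = x * complex.Im z.
Proof. by case: z => a b /=; rewrite mul0r addr0. Qed.

Lemma normc_lt (R : realType) (z : R[i]) (e : R) : 0 < e ->
  `|complex.Re z| <= e / 2 -> `|complex.Im z| <= e / 2 -> `|z| < e%:C.
Proof.
move=> e0 hr hi; rewrite normc_def ltcR -[ltRHS]ger0_norm ?ltW // -sqrtr_sqr.
rewrite ltr_sqrt ?exprn_gt0 // -[_ ^+ 2]real_normK ?num_real // -[complex.Im z ^+ 2]real_normK ?num_real //.
have := normr_ge0 (complex.Re z); have := normr_ge0 (complex.Im z); nra.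
Qed.

Theorem theorem1p1 (R : realType) (f : nat -> R[i]^o) (hf : bounded_fun f) :
  (fun N : nat =>
     (N%:R : R[i])^-1 * \sum_(1 <= n < N.+1) f (num_prime_factors n + 1)%N
     - (N%:R : R[i])^-1 * \sum_(1 <= n < N.+1) f (num_prime_factors n))
    @ \oo --> (0 : R[i]^o).
Proof.
have [M _ hM] := pinfty_ex_gt0 hf.
have hre k : `|complex.Re (f k)| <= complex.Re M.
  by have := le_trans (normc_ge_Re _) (hM k I); rewrite lecE => /andP[].
have him k : `|complex.Im (f k)| <= complex.Re M.
  have := hM k I; rewrite /= normc_def lecE => /andP[_]; apply: le_trans.
  by rewrite -sqrtr_sqr ler_sqrt ?addr_ge0 ?sqr_ge0 // lerDr sqr_ge0.
(* A positive element of [R[i]] has zero imaginary part, so the tolerance is a real number e. *)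
apply/(@cvgr0Pnorm_lt _ (R[i]^o : normedModType R[i]) _ \oo) => -[e e'] /=; rewrite ltcE /= => /andP[/eqP -> e0].
have e2 : 0 < e / 2 by lra.
have [N1 h1] := omega_sum_shift_small R _ _ _ hre e2.
have [N2 h2] := omega_sum_shift_small R _ _ _ him e2.
(* The bound 1 excludes N = 0, where the inverse takes its default value. *)
exists (maxn 1 (maxn N1 N2)) => // N /=; rewrite !geq_max => /and3P[N0 /h1 {}h1 /h2 {}h2].
have N0' : 0 < N%:R :> R by rewrite ltr0n.
rewrite -mulrBr.
have -> : (N%:R : R[i])^-1 = (N%:R^-1)%:C by rewrite fmorphV rmorph_nat.
have reS (h : nat -> R[i]) : complex.Re (\sum_(1 <= n < N.+1) h n) = \sum_(1 <= n < N.+1) complex.Re (h n).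
  by apply: (big_morph (@complex.Re R)) => // -[a b] [c d].
have imS (h : nat -> R[i]) : complex.Im (\sum_(1 <= n < N.+1) h n) = \sum_(1 <= n < N.+1) complex.Im (h n).
  by apply: (big_morph (@complex.Im R)) => // -[a b] [c d].
have mean (x : R) : `|x| <= e / 2 * N%:R -> `|N%:R^-1 * x| <= e / 2.
  by move=> hx; rewrite normrM gtr0_norm ?invr_gt0 // ler_pdivrMl // mulrC.
have reB (x y : R[i]) : complex.Re (x - y) = complex.Re x - complex.Re y.
  by case: x y => a b [].
have imB (x y : R[i]) : complex.Im (x - y) = complex.Im x - complex.Im y.
  by case: x y => a b [].
apply: normc_lt => //.
- rewrite Re_real_mul reB !reS; apply: mean; apply: le_trans h1.
  by under eq_bigr => n _ do rewrite addn1.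
- rewrite Im_real_mul imB !imS; apply: mean; apply: le_trans h2.
  by under eq_bigr => n _ do rewrite addn1.
Qed.
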